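(* The theory CC$''$ weakly interprets intuitionistic second order Peano arithmetic minus the induction axiom; that is, for every theorem $\varphi$ of that theory there is a theorem $\psi$ of CC$''$ such that deleting every occurrence of $\Box$ from $\psi$ yields $\varphi$.
   Context: CC is the following system. Its language is the language of set theory ($\in$, $=$) augmented by a unary operator $\Box$, with formulas closed under $\wedge,\vee,\to,\forall,\exists$ and under $A\mapsto\Box A$; $\bot$ abbreviates $(\forall x)(\forall y)(x\in y)$ and $\neg A$ abbreviates $A\to\bot$. Its axioms and rules are those of intuitionistic predicate calculus with equality, plus: $A\to\Box A$; $\Box(A\wedge B)\leftrightarrow(\Box A\wedge\Box B)$; $\Box(A\vee B)\leftrightarrow(\Box A\vee\Box B)$; $\Box((\exists x)A)\leftrightarrow(\exists x)\Box A$; $\Box((\forall x)A)\leftrightarrow(\forall x)\Box A$; $\Box(A\to B)\to(\Box A\to\Box B)$; the rule ''from $\Box A$ infer $A$''; extensionality $x=y\leftrightarrow(\forall u)(u\in x\leftrightarrow u\in y)$; and the comprehension scheme $(\exists x)(\forall r)(r\in x\leftrightarrow\Box A)$ for a fixed variable $r$, any variable $x$, and any formula $A$ in which $x$ is not free. CC$''$ is the extension of CC by definitions obtained by adding a constant $0$ with axiom $r\in 0\leftrightarrow\Box\bot$, a unary function symbol $S$ with axiom $r\in Sx\leftrightarrow\Box(r=x)$, and a constant $\omega$ with axiom $r\in\omega\leftrightarrow\Box(\forall z)[(0\in z\wedge(\forall x)(x\in z\to Sx\in z))\to r\in z]$. Intuitionistic second order Peano arithmetic minus induction is here understood in the same language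 minus $\Box$ (symbols $\in,=,0,S,\omega$, the natural numbers being the members of $\omega$), over intuitionistic logic, with the axioms $0\in\omega$; $x\in\omega\to Sx\in\omega$; $\neg(Sx=0)$; $Sx=Sy\to x=y$. A theory $\mathcal{T}_2$ in a language with $\Box$ weakly interprets a theory $\mathcal{T}_1$ in the same language without $\Box$ if every theorem of $\mathcal{T}_1$ is obtained from some theorem of $\mathcal{T}_2$ by deleting all boxes. *)

(* Defs.v *)
From Stdlib Require Import Arith Bool.

Inductive term : Type :=
| tvar : nat -> term
| tzero : term
| tsucc : term -> term
| tomega : term.

Inductive form : Type :=
| Mem : term -> term -> form
| Eq : term -> term -> form
| And : form -> form -> form
| Or : form -> form -> form
| Imp : form -> form -> form
| All : form -> form
| Ex : form -> form
| Box : form -> form.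

Definition bot : form := All (All (Mem (tvar 1) (tvar 0))).
Definition Neg (A : form) : form := Imp A bot.
Definition Iff (A B : form) : form := And (Imp A B) (Imp B A).

Fixpoint lift_term (k : nat) (t : term) : term :=
  match t with
  | tvar n => if n <? k then tvar n else tvar (S n)
  | tzero => tzero
  | tsucc u => tsucc (lift_term k u)
  | tomega => tomega
  end.

Fixpoint lift (k : nat) (A : form) : form :=
  match A with
  | Mem t u => Mem (lift_term k t) (lift_term k u)
  | Eq t u => Eq (lift_term k t) (lift_term k u)
  | And B C => And (lift k B) (lift k C)
  | Or B C => Or (lift k B) (lift k C)
  | Imp B C => Imp (lift k B) (lift k C)
  | All B => All (lift (S k) B)
  | Ex B => Ex (lift (S k) B)
  | Box B => Box (lift k B)
  end.

Fixpoint subst_term (k : nat) (s : term) (t : term) : term :=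
  match t with
  | tvar n => if n =? k then s else if n <? k then tvar n else tvar (pred n)
  | tzero => tzero
  | tsucc u => tsucc (subst_term k s u)
  | tomega => tomega
  end.

Fixpoint subst (k : nat) (s : term) (A : form) : form :=
  match A with
  | Mem t u => Mem (subst_term k s t) (subst_term k s u)
  | Eq t u => Eq (subst_term k s t) (subst_term k s u)
  | And B C => And (subst k s B) (subst k s C)
  | Or B C => Or (subst k s B) (subst k s C)
  | Imp B C => Imp (subst k s B) (subst k s C)
  | All B => All (subst (S k) (lift_term 0 s) B)
  | Ex B => Ex (subst (S k) (lift_term 0 s) B)
  | Box B => Box (subst k s B)
  end.

Definition inst (A : form) (t : term) : form := subst 0 t A.

Fixpoint erase (A : form) : form :=
  match A with
  | Mem t u => Mem t u
  | Eq t u => Eq t u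
  | And B C => And (erase B) (erase C)
  | Or B C => Or (erase B) (erase C)
  | Imp B C => Imp (erase B) (erase C)
  | All B => All (erase B)
  | Ex B => Ex (erase B)
  | Box B => erase B
  end.

Fixpoint boxfree (A : form) : bool :=
  match A with
  | Mem _ _ | Eq _ _ => true
  | And B C | Or B C | Imp B C => boxfree B && boxfree C
  | All B | Ex B => boxfree B
  | Box _ => false
  end.

Inductive LogAx : form -> Prop :=
| ax_K A B : LogAx (Imp A (Imp B A))
| ax_S A B C : LogAx (Imp (Imp A (Imp B C)) (Imp (Imp A B) (Imp A C)))
| ax_andE1 A B : LogAx (Imp (And A B) A)
| ax_andE2 A B : LogAx (Imp (And A B) B)
| ax_andI A B : LogAx (Imp A (Imp B (And A B)))
| ax_orI1 A B : LogAx (Imp A (Or A B))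
| ax_orI2 A B : LogAx (Imp B (Or A B))
| ax_orE A B C : LogAx (Imp (Imp A C) (Imp (Imp B C) (Imp (Or A B) C)))
| ax_efq A : LogAx (Imp bot A)
| ax_allE A t : LogAx (Imp (All A) (inst A t))
| ax_exI A t : LogAx (Imp (inst A t) (Ex A))
| ax_eqrefl t : LogAx (Eq t t)
| ax_eqsubst A t u : LogAx (Imp (Eq t u) (Imp (inst A t) (inst A u))).

Inductive BoxAx : form -> Prop :=
| bx_T A : BoxAx (Imp A (Box A))
| bx_and A B : BoxAx (Iff (Box (And A B)) (And (Box A) (Box B)))
| bx_or A B : BoxAx (Iff (Box (Or A B)) (Or (Box A) (Box B)))
| bx_ex A : BoxAx (Iff (Box (Ex A)) (Ex (Box A)))
| bx_all A : BoxAx (Iff (Box (All A)) (All (Box A)))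
| bx_K A B : BoxAx (Imp (Box (Imp A B)) (Imp (Box A) (Box B))).

(* Derivability.  [m = true]: language with □, the □-axioms and the rule
   "from □A infer A" are available.  [m = false]: language without □
   (every logical-axiom instance must be □-free).  [Ax]: non-logical axioms. *)
Inductive Derivable (m : bool) (Ax : form -> Prop) : form -> Prop :=
| d_ax A : Ax A -> Derivable m Ax A
| d_log A : LogAx A -> m || boxfree A = true -> Derivable m Ax A
| d_box A : m = true -> BoxAx A -> Derivable m Ax A
| d_mp A B : Derivable m Ax (Imp A B) -> Derivable m Ax A -> Derivable m Ax B
| d_gen A : Derivable m Ax A -> Derivable m Ax (All A)
| d_allI A B : Derivable m Ax (Imp (lift 0 B) A) -> Derivable m Ax (Imp B (All A))
| d_exE A B : Derivable m Ax (Imp A (lift 0 B)) -> Derivable m Ax (Imp (Ex A) B)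
| d_unbox A : m = true -> Derivable m Ax (Box A) -> Derivable m Ax A.

Inductive CC2Ax : form -> Prop :=
| cc_ext i j : CC2Ax (Iff (Eq (tvar i) (tvar j))
                         (All (Iff (Mem (tvar 0) (tvar (S i)))
                                   (Mem (tvar 0) (tvar (S j))))))
(* comprehension: (∃x)(∀r)(r ∈ x <-> □A), x not free in A.
   In A, index 0 is r; the lift at cutoff 1 makes x (index 1 under ∃x∀r)
   not occur in A. *)
| cc_comp A : CC2Ax (Ex (All (Iff (Mem (tvar 0) (tvar 1)) (Box (lift 1 A)))))
| cc_zero i : CC2Ax (Iff (Mem (tvar i) tzero) (Box bot))
| cc_succ i j : CC2Ax (Iff (Mem (tvar i) (tsucc (tvar j))) (Box (Eq (tvar i) (tvar j))))
| cc_omega i : CC2Ax (Iff (Mem (tvar i) tomega)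
      (Box (All (Imp (And (Mem tzero (tvar 0))
                          (All (Imp (Mem (tvar 0) (tvar 1))
                                    (Mem (tsucc (tvar 0)) (tvar 1)))))
                     (Mem (tvar (S i)) (tvar 0)))))).

Definition CC2_thm (A : form) : Prop := Derivable true CC2Ax A.

Inductive PAmAx : form -> Prop :=
| pa_zero : PAmAx (Mem tzero tomega)
| pa_succ i : PAmAx (Imp (Mem (tvar i) tomega) (Mem (tsucc (tvar i)) tomega))
| pa_nz i : PAmAx (Neg (Eq (tsucc (tvar i)) tzero))
| pa_inj i j : PAmAx (Imp (Eq (tsucc (tvar i)) (tsucc (tvar j))) (Eq (tvar i) (tvar j))).

Definition PAm_thm (A : form) : Prop := Derivable false PAmAx A.

Definition weakly_interprets (T2 T1 : form -> Prop) : Prop :=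
  forall phi, T1 phi -> exists psi, T2 psi /\ erase psi = phi.

(* Main.v *)
(** Positive implications [A -> B] are translated as [A -> □^N B], negative
    ones are left alone.  Every cut-free proof survives this translation as
    soon as [N] bounds the number of uses of [Sx = 0 -> ⊥] and
    [Sx = Sy -> x = y], each of which costs one [□]: a sequent is read as
    "[Γ] entails [□^k C] for some [k]", the rule for a positive implication
    absorbs [k] into [N], and a negative implication can be applied under [□^k]
    because [A -> □A].  Cut is not admissible for this reading, so cuts are
    eliminated semantically: formulas are interpreted as sets of contexts closed
    under the cut-free rules (Okada's method), the Hilbert calculus is sound for
    this interpretation, and every valid formula has a cut-free proof. *)
From Stdlib Require Import Arith Bool List Lia.
Require Import Defs.
Import ListNotations.

(** * Parallel substitution *)

Fixpoint tsb (e : nat -> term) (t : term) : term :=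
  match t with
  | tvar n => e n
  | tzero => tzero
  | tsucc u => tsucc (tsb e u)
  | tomega => tomega
  end.

Definition scons (t : term) (e : nat -> term) (n : nat) : term :=
  match n with 0 => t | S m => e m end.

Definition up (e : nat -> term) : nat -> term :=
  scons (tvar 0) (fun n => lift_term 0 (e n)).

Fixpoint sb (e : nat -> term) (A : form) : form :=
  match A with
  | Mem t u => Mem (tsb e t) (tsb e u)
  | Eq t u => Eq (tsb e t) (tsb e u)
  | And B C => And (sb e B) (sb e C)
  | Or B C => Or (sb e B) (sb e C)
  | Imp B C => Imp (sb e B) (sb e C)
  | All B => All (sb (up e) B)
  | Ex B => Ex (sb (up e) B)
  | Box B => Box (sb e B)
  end.

(* A strict upper bound on the free indices. *)
Fixpoint tbound (t : term) : nat :=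
  match t with
  | tvar n => S n
  | tsucc u => tbound u
  | _ => 0
  end.

Fixpoint bound (A : form) : nat :=
  match A with
  | Mem t u | Eq t u => max (tbound t) (tbound u)
  | And B C | Or B C | Imp B C => max (bound B) (bound C)
  | All B | Ex B => pred (bound B)
  | Box B => bound B
  end.

Lemma tsb_agree t e f :
  (forall n, n < tbound t -> e n = f n) -> tsb e t = tsb f t.
Proof.
  induction t; simpl; intros H; auto; f_equal; auto.
Qed.

Lemma sb_agree A : forall e f,
  (forall n, n < bound A -> e n = f n) -> sb e A = sb f A.
Proof.
  induction A; simpl; intros e f H;
    f_equal; try (apply tsb_agree; intros; apply H; lia);
    try (apply IHA1; intros; apply H; lia);
    try (apply IHA2; intros; apply H; lia); auto;
    apply IHA; intros [|n] Hn; simpl; auto; rewrite H; auto; lia.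
Qed.

Lemma tsb_ext t e f : (forall n, e n = f n) -> tsb e t = tsb f t.
Proof. intros; apply tsb_agree; auto. Qed.

Lemma sb_ext A e f : (forall n, e n = f n) -> sb e A = sb f A.
Proof. intros; apply sb_agree; auto. Qed.

Lemma tsb_id t : tsb tvar t = t.
Proof. induction t; simpl; congruence. Qed.

Lemma sb_id A : sb tvar A = A.
Proof.
  assert (Hup : forall B, sb (up tvar) B = sb tvar B)
    by (intros; apply sb_ext; intros [|n]; reflexivity).
  induction A; simpl; rewrite ?tsb_id, ?Hup; congruence.
Qed.

Lemma lift0_tsb t : lift_term 0 t = tsb (fun n => tvar (S n)) t.
Proof. induction t; simpl; congruence. Qed.

Lemma tsb_comp t e f : tsb f (tsb e t) = tsb (fun n => tsb f (e n)) t.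
Proof. induction t; simpl; congruence. Qed.

Lemma sb_comp A : forall e f, sb f (sb e A) = sb (fun n => tsb f (e n)) A.
Proof.
  assert (Hup : forall B e f,
    sb (fun n => tsb (up f) (up e n)) B = sb (up (fun n => tsb f (e n))) B).
  { intros; apply sb_ext; intros [|n]; simpl; auto.
    rewrite !lift0_tsb, !tsb_comp; apply tsb_ext; intros m.
    simpl; now rewrite lift0_tsb. }
  induction A; intros e f; simpl; f_equal; auto using tsb_comp;
    now rewrite IHA, Hup.
Qed.

(** * Lifting and single substitution as parallel substitutions *)

Definition lift_env (k n : nat) : term := if n <? k then tvar n else tvar (S n).

Lemma lift_term_tsb t k : lift_term k t = tsb (lift_env k) t.
Proof. induction t; simpl; auto; congruence. Qed.

Lemma lift_sb A : forall k, lift k A = sb (lift_env k) A.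
Proof.
  assert (Hup : forall B k, sb (up (lift_env k)) B = sb (lift_env (S k)) B).
  { intros; apply sb_ext; intros [|n]; auto; unfold lift_env; simpl.
    change (S n <? S k) with (n <? k); destruct (n <? k); reflexivity. }
  induction A; intros k; simpl; rewrite ?lift_term_tsb, ?Hup; congruence.
Qed.

Definition subst_env (k : nat) (s : term) (n : nat) : term :=
  if n =? k then s else if n <? k then tvar n else tvar (pred n).

Lemma subst_term_tsb t k s : subst_term k s t = tsb (subst_env k s) t.
Proof. induction t; simpl; auto; congruence. Qed.

Lemma subst_sb A : forall k s, subst k s A = sb (subst_env k s) A.
Proof.
  assert (Hup : forall B k s,
    sb (up (subst_env k s)) B = sb (subst_env (S k) (lift_term 0 s)) B).
  { intros; apply sb_ext; intros [|n]; auto; unfold subst_env; simpl.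
    change (S n <? S k) with (n <? k).
    destruct (n =? k) eqn:E1; auto; destruct (n <? k) eqn:E2; auto.
    apply Nat.eqb_neq in E1; apply Nat.ltb_ge in E2.
    destruct n; [lia | reflexivity]. }
  induction A; intros k s; simpl; rewrite ?subst_term_tsb, ?Hup; congruence.
Qed.

Lemma lift0_sb A : lift 0 A = sb (fun n => tvar (S n)) A.
Proof. apply lift_sb. Qed.

Lemma inst_sb A t : inst A t = sb (scons t tvar) A.
Proof.
  unfold inst; rewrite subst_sb; apply sb_ext; intros [|n]; reflexivity.
Qed.

Lemma tsb_scons_lift u t e : tsb (scons t e) (lift_term 0 u) = tsb e u.
Proof. now rewrite lift0_tsb, tsb_comp. Qed.

Lemma subst_lift_term u t : subst_term 0 t (lift_term 0 u) = u.
Proof.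
  rewrite subst_term_tsb, lift0_tsb, tsb_comp.
  rewrite (tsb_ext u _ tvar); [apply tsb_id | intros; reflexivity].
Qed.

Lemma sb_inst A t e : sb e (inst A t) = sb (scons (tsb e t) e) A.
Proof.
  rewrite inst_sb, sb_comp; apply sb_ext; intros [|n]; reflexivity.
Qed.

Lemma inst_up A t e : inst (sb (up e) A) t = sb (scons t e) A.
Proof.
  rewrite inst_sb, sb_comp; apply sb_ext; intros [|n]; simpl; auto.
  rewrite tsb_scons_lift; apply tsb_id.
Qed.

Lemma sb_inst_up A t e : sb e (inst A t) = inst (sb (up e) A) (tsb e t).
Proof. now rewrite inst_up, sb_inst. Qed.

Lemma sb_lift A e : sb (up e) (lift 0 A) = lift 0 (sb e A).
Proof.
  rewrite !lift0_sb, !sb_comp; apply sb_ext; intros n; simpl.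
  apply lift0_tsb.
Qed.

(** * The calculus CC'' *)

Definition rename (r : nat -> nat) : form -> form := sb (fun n => tvar (r n)).

Lemma LogAx_sb e A : LogAx A -> LogAx (sb e A).
Proof.
  intros []; simpl; rewrite ?sb_inst_up; constructor.
Qed.

Lemma BoxAx_sb e A : BoxAx A -> BoxAx (sb e A).
Proof. intros []; simpl; constructor. Qed.

(** The axioms speak of variables and not of arbitrary terms, so as a set they are stable under
    renamings only. Renaming suffices for exchanging eigenvariables. *)
Lemma CC2Ax_rename r A : CC2Ax A -> CC2Ax (rename r A).
Proof.
  unfold rename; intros []; simpl; try constructor.
  replace (sb _ (lift 1 A0))
    with (lift 1 (sb (up (fun n => tvar (r n))) A0)); [constructor|].
  rewrite !lift_sb, !sb_comp; apply sb_ext; intros [|n]; reflexivity.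
Qed.

Lemma CC2_rename A : CC2_thm A -> forall r, CC2_thm (rename r A).
Proof.
  unfold CC2_thm, rename.
  (* A renaming pushed under a binder is again a renaming, so the induction stays within
     renamings. *)
  assert (Hup : forall B r, sb (up (fun n => tvar (r n))) B =
    sb (fun n => tvar (match n with 0 => 0 | S m => S (r m) end)) B)
    by (intros; apply sb_ext; intros [|n]; reflexivity).
  induction 1 as [A H|A H|A _ H|A B _ IH1 _ IH2|A _ IH|A B _ IH|A B _ IH|A _ _ IH];
    intros r; simpl.
  - now apply d_ax, CC2Ax_rename.
  - now apply d_log; [apply LogAx_sb|].
  - now apply d_box; [|apply BoxAx_sb].
  - exact (d_mp _ _ _ _ (IH1 r) (IH2 r)).
  - apply d_gen; rewrite Hup; apply IH.
  - apply d_allI; rewrite Hup, <- sb_lift, Hup; apply (IH _).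
  - apply d_exE; rewrite Hup, <- sb_lift, Hup; apply (IH _).
  - now apply d_unbox; [|apply IH].
Qed.

(** * Derived rules for reasoning under hypotheses in CC'' *)

Definition conj : list form -> form := fold_right And (Imp bot bot).

(** The hypotheses form the antecedent of one theorem. Generalization and unboxing, which act on
    theorems only, thus never act on a conclusion that still depends on hypotheses. *)
Definition entails (G : list form) (A : form) : Prop :=
  CC2_thm (Imp (conj G) A).

Lemma thm_log A : LogAx A -> CC2_thm A.
Proof. intros; now apply d_log. Qed.

Lemma thm_mp A B : CC2_thm (Imp A B) -> CC2_thm A -> CC2_thm B.
Proof. apply d_mp. Qed.

Lemma thm_const A B : CC2_thm B -> CC2_thm (Imp A B).
Proof. apply thm_mp, thm_log, ax_K. Qed.

Lemma thm_ap A B C :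
  CC2_thm (Imp A (Imp B C)) -> CC2_thm (Imp A B) -> CC2_thm (Imp A C).
Proof.
  intros H; apply thm_mp; revert H; apply thm_mp, thm_log, ax_S.
Qed.

Lemma thm_trans A B C :
  CC2_thm (Imp A B) -> CC2_thm (Imp B C) -> CC2_thm (Imp A C).
Proof. intros H1 H2; exact (thm_ap _ _ _ (thm_const _ _ H2) H1). Qed.

Lemma thm_swap A B C : CC2_thm (Imp A (Imp B C)) -> CC2_thm (Imp B (Imp A C)).
Proof.
  intros H; eapply thm_trans; [apply thm_log, ax_K|].
  eapply thm_mp; [apply thm_log, ax_S | exact H].
Qed.

Lemma thm_id A : CC2_thm (Imp A A).
Proof.
  eapply thm_ap; apply thm_log; [apply (ax_K A (Imp A A)) | apply ax_K].
Qed.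

Lemma entails_thm G A : CC2_thm A -> entails G A.
Proof. apply thm_const. Qed.

Lemma entails_mp G A B : entails G (Imp A B) -> entails G A -> entails G B.
Proof. apply thm_ap. Qed.

Lemma entails_app G A B : CC2_thm (Imp A B) -> entails G A -> entails G B.
Proof. intros; eapply entails_mp; eauto using entails_thm. Qed.

Lemma entails_log G A B : LogAx (Imp A B) -> entails G A -> entails G B.
Proof. intros H; now apply entails_app, thm_log. Qed.

Lemma entails_hyp G A : In A G -> entails G A.
Proof.
  unfold entails; induction G as [|B G IH]; simpl; intros [].
  - subst; apply thm_log, ax_andE1.
  - eapply thm_trans; [apply thm_log, ax_andE2 | auto].
Qed.

Lemma entails_intro G A B : entails (A :: G) B -> entails G (Imp A B).
Proof.
  unfold entails; simpl; intros H.
  assert (H1 : CC2_thm (Imp (conj G) (Imp A (And A (conj G))))).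
  { apply thm_ap with (B := Imp A (conj G)); [|apply thm_log, ax_K].
    apply thm_const; eapply thm_mp; [apply thm_log, ax_S|].
    apply thm_log, ax_andI. }
  eapply thm_trans; [exact H1|].
  eapply thm_mp; [apply thm_log, ax_S | now apply thm_const].
Qed.

Lemma entails_conj G G' : incl G' G -> entails G (conj G').
Proof.
  induction G' as [|A G' IH]; intros H; simpl.
  - apply entails_thm, thm_id.
  - eapply entails_mp; [eapply entails_log; [apply ax_andI|]|].
    + apply entails_hyp, H; now left.
    + apply IH; intros x Hx; apply H; now right.
Qed.

Lemma entails_weak G G' A : incl G G' -> entails G A -> entails G' A.
Proof. intros H HA; eapply thm_trans; [apply entails_conj, H | exact HA]. Qed.

Lemma entails_cons G A B : entails G A -> entails (B :: G) A.
Proof. apply entails_weak; now right. Qed.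

Lemma entails_cut G A B : entails G A -> entails (A :: G) B -> entails G B.
Proof. intros HA HB; eapply entails_mp; [apply entails_intro, HB | exact HA]. Qed.

Lemma entails_and G A B : entails G A -> entails G B -> entails G (And A B).
Proof.
  intros HA; apply entails_mp; revert HA; apply entails_log, ax_andI.
Qed.

Lemma thm_entails A B : entails [A] B -> CC2_thm (Imp A B).
Proof.
  intros H; exact (thm_mp _ _ (entails_intro _ _ _ H) (thm_id bot)).
Qed.

Lemma conj_lift G : conj (map (lift 0) G) = lift 0 (conj G).
Proof. induction G as [|A G IH]; simpl; [reflexivity | now rewrite IH]. Qed.

Lemma entails_allI G A : entails (map (lift 0) G) A -> entails G (All A).
Proof. unfold entails; rewrite conj_lift; apply d_allI. Qed.

Lemma entails_allE G A t : entails G (All A) -> entails G (inst A t).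
Proof. apply entails_log, ax_allE. Qed.

Lemma entails_exE G A B :
  entails (A :: map (lift 0) G) (lift 0 B) -> entails (Ex A :: G) B.
Proof.
  intros H.
  assert (H1 : CC2_thm (Imp (Ex A) (Imp (conj G) B))).
  { apply d_exE; simpl; rewrite <- conj_lift.
    now apply thm_swap, entails_intro. }
  eapply entails_mp; [apply (entails_app _ (Ex A) _ H1)|].
  - apply entails_hyp; now left.
  - apply entails_conj; intros x Hx; now right.
Qed.

Lemma entails_orE G A B C :
  entails (A :: G) C -> entails (B :: G) C -> entails (Or A B :: G) C.
Proof.
  intros HA HB; apply entails_intro in HA, HB.
  eapply entails_mp; [|apply entails_hyp; now left].
  apply entails_cons; eapply entails_mp; [|exact HB].
  revert HA; apply entails_log, ax_orE.
Qed.

Lemma thm_iff1 A B : CC2_thm (Iff A B) -> CC2_thm (Imp A B).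
Proof. apply thm_mp, thm_log, ax_andE1. Qed.

Lemma thm_iff2 A B : CC2_thm (Iff A B) -> CC2_thm (Imp B A).
Proof. apply thm_mp, thm_log, ax_andE2. Qed.

(** * Iterated boxes *)

Fixpoint boxes (k : nat) (A : form) : form :=
  match k with 0 => A | S k => Box (boxes k A) end.

Lemma boxes_boxes k l A : boxes k (boxes l A) = boxes (k + l) A.
Proof. induction k; simpl; congruence. Qed.

Lemma sb_boxes e k A : sb e (boxes k A) = boxes k (sb e A).
Proof. induction k; simpl; congruence. Qed.

Lemma entails_boxI G k A : entails G A -> entails G (boxes k A).
Proof.
  intros H; induction k; simpl; auto.
  revert IHk; apply entails_app, d_box; [reflexivity | constructor].
Qed.

(* Hypotheses may be kept under the box because of [A -> □A]. *)
Lemma entails_bind G k A B :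
  entails G (boxes k A) -> entails (A :: G) B -> entails G (boxes k B).
Proof.
  revert G; induction k as [|k IH]; simpl; intros G HA HB.
  - exact (entails_cut _ _ _ HA HB).
  - apply entails_mp with (2 := HA).
    apply (entails_app _ (Box (Imp (boxes k A) (boxes k B)))).
    + apply d_box; [reflexivity | constructor].
    + apply (entails_boxI _ 1), entails_intro, IH.
      * apply entails_hyp; now left.
      * revert HB; apply entails_weak; intros x []; simpl; auto.
Qed.

Lemma entails_boxes_mono G k l A :
  k <= l -> entails G (boxes k A) -> entails G (boxes l A).
Proof.
  intros H; replace l with ((l - k) + k) by lia.
  rewrite <- boxes_boxes; apply entails_boxI.
Qed.

Lemma entails_boxes_app G k A B :
  CC2_thm (Imp A B) -> entails G (boxes k A) -> entails G (boxes k B).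
Proof.
  intros H HA; apply (entails_bind _ _ _ _ HA).
  apply (entails_app _ _ _ H), entails_hyp; now left.
Qed.

(** Each box is moved outward by the direction ∀□ to □∀ of [bx_all]; the remaining [k] are moved
    under that box by [entails_bind]. *)
Lemma entails_boxes_all G k A :
  entails G (All (boxes k A)) -> entails G (boxes k (All A)).
Proof.
  revert G; induction k as [|k IH]; simpl; intros G HA; auto.
  apply (entails_bind _ 1 (All (boxes k A))).
  - revert HA; apply entails_app, thm_iff2, d_box; [reflexivity | constructor].
  - apply IH, entails_hyp; now left.
Qed.

(** * Arithmetic in CC'' *)

Lemma thm_allE A t : CC2_thm A -> CC2_thm (inst A t).
Proof.
  intros H; eapply thm_mp; [apply thm_log, ax_allE | now apply d_gen].
Qed.

Lemma thm_zero t : CC2_thm (Iff (Mem t tzero) (Box bot)).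
Proof. exact (thm_allE _ t (d_ax _ _ _ (cc_zero 0))). Qed.

Lemma thm_succ t u : CC2_thm (Iff (Mem t (tsucc u)) (Box (Eq t u))).
Proof.
  (* Index 0 of the axiom is replaced by the lifted [u] first; index 1 then becomes 0 and receives
     [t], which also undoes the lift of [u]. *)
  pose proof (thm_allE _ t (thm_allE _ (lift_term 0 u)
    (d_ax _ _ _ (cc_succ 1 0)))) as H.
  unfold inst in H; simpl in H; now rewrite subst_lift_term in H.
Qed.

Definition inductive : form :=
  And (Mem tzero (tvar 0))
      (All (Imp (Mem (tvar 0) (tvar 1)) (Mem (tsucc (tvar 0)) (tvar 1)))).

Lemma thm_omega t : CC2_thm (Iff (Mem t tomega)
  (Box (All (Imp inductive (Mem (lift_term 0 t) (tvar 0)))))).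
Proof. exact (thm_allE _ t (d_ax _ _ _ (cc_omega 0))). Qed.

Lemma thm_zero_omega : CC2_thm (Mem tzero tomega).
Proof.
  eapply thm_mp; [apply thm_iff2, thm_omega|].
  eapply thm_mp; [apply d_box; [reflexivity | apply bx_T]|].
  apply d_gen, thm_log, ax_andE1.
Qed.

(** No box is gained: both memberships unfold to boxed formulas, and the implication between their
    bodies is proved outright, boxed by [bx_T] and distributed by [bx_K]. *)
Lemma thm_succ_omega t :
  CC2_thm (Imp (Mem t tomega) (Mem (tsucc t) tomega)).
Proof.
  eapply thm_trans; [apply thm_iff1, thm_omega|].
  eapply thm_trans; [|apply thm_iff2, thm_omega].
  eapply thm_mp; [apply d_box; [reflexivity | apply bx_K]|].
  eapply thm_mp; [apply d_box; [reflexivity | apply bx_T]|].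
  apply d_allI; simpl lift; fold inductive.
  set (H := All _).
  apply thm_entails, entails_intro; simpl.
  apply (entails_mp _ (Mem (lift_term 0 t) (tvar 0))).
  - apply (entails_allE _ (Imp (Mem (tvar 0) (tvar 1))
      (Mem (tsucc (tvar 0)) (tvar 1))) (lift_term 0 t)).
    eapply entails_log; [apply ax_andE2|]; apply entails_hyp; now left.
  - apply (entails_mp _ inductive); [|apply entails_hyp; now left].
    assert (E : entails [inductive; H] H) by (apply entails_hyp; simpl; auto).
    apply (entails_allE _ _ (tvar 0)) in E; unfold inst in E; simpl in E.
    replace (subst_term 0 _ _) with (lift_term 0 t) in E; [exact E|].
    rewrite !lift_term_tsb, subst_term_tsb, !tsb_comp.
    apply tsb_ext; intros n; reflexivity.
Qed.

Lemma thm_eq_mem s t u :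
  CC2_thm (Imp (Eq s t) (Imp (Mem u s) (Mem u t))).
Proof.
  pose proof (thm_log _ (ax_eqsubst (Mem (lift_term 0 u) (tvar 0)) s t)) as H.
  unfold inst in H; simpl in H; now rewrite !subst_lift_term in H.
Qed.

Lemma thm_mem_succ t : CC2_thm (Mem t (tsucc t)).
Proof.
  eapply thm_mp; [apply thm_iff2, thm_succ|].
  eapply thm_mp; [apply d_box; [reflexivity | apply bx_T]|].
  apply thm_log, ax_eqrefl.
Qed.

(** Since [t] lies in its own successor, it lies in anything equal to that successor. Unfolding
    membership in [u] then yields both laws below, each with the one box of the defining axiom. *)
Lemma thm_succ_eq t u : CC2_thm (Imp (Eq (tsucc t) u) (Mem t u)).
Proof.
  eapply thm_ap; [apply thm_eq_mem | apply thm_const, thm_mem_succ].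
Qed.

Lemma thm_succ_neq_zero t : CC2_thm (Imp (Eq (tsucc t) tzero) (Box bot)).
Proof. eapply thm_trans; [apply thm_succ_eq | apply thm_iff1, thm_zero]. Qed.

Lemma thm_succ_inj t u :
  CC2_thm (Imp (Eq (tsucc t) (tsucc u)) (Box (Eq t u))).
Proof. eapply thm_trans; [apply thm_succ_eq | apply thm_iff1, thm_succ]. Qed.

(** * Cut-free sequents *)

Fixpoint T (N : nat) (pos : bool) (A : form) : form :=
  match A with
  | Mem t u => Mem t u
  | Eq t u => Eq t u
  | And B C => And (T N pos B) (T N pos C)
  | Or B C => Or (T N pos B) (T N pos C)
  | Imp B C => Imp (T N (negb pos) B) (boxes (if pos then N else 0) (T N pos C))
  | All B => All (T N pos B)
  | Ex B => Ex (T N pos B)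
  | Box B => T N pos B
  end.

Lemma erase_boxes k A : erase (boxes k A) = erase A.
Proof. induction k; auto. Qed.

Lemma erase_T N A : forall pos, erase (T N pos A) = erase A.
Proof.
  induction A; intros pos; simpl; rewrite ?erase_boxes; congruence.
Qed.

Lemma T_sb N A : forall pos e, T N pos (sb e A) = sb e (T N pos A).
Proof.
  induction A; intros pos e; simpl; rewrite ?sb_boxes; congruence.
Qed.

Lemma T_inst N A pos t : T N pos (inst A t) = inst (T N pos A) t.
Proof. now rewrite !inst_sb, T_sb. Qed.

(** The number [k] is fixed before [N] and must serve all larger [N]: different subderivations have
    different [k], and [N] is chosen only once the whole derivation is known. *)
Definition seqt (G : list form) (C : form) : Prop :=
  exists k, forall N, k <= N ->
    entails (map (T N false) G) (boxes k (T N true C)).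

Lemma seqt_weak G G' C : incl G G' -> seqt G C -> seqt G' C.
Proof.
  intros H [k Hk]; exists k; intros N HN; generalize (Hk N HN).
  now apply entails_weak, incl_map.
Qed.

Lemma T_In N G A : In A G -> entails (map (T N false) G) (T N false A).
Proof. intros; now apply entails_hyp, in_map. Qed.

Lemma seqt_andL1 G A B C : In (And A B) G -> seqt (A :: G) C -> seqt G C.
Proof.
  intros Hin [k Hk]; exists k; intros N HN.
  refine (entails_cut _ _ _ _ (Hk N HN)).
  apply (entails_log _ _ _ (ax_andE1 _ (T N false B))), (T_In N _ _ Hin).
Qed.

Lemma seqt_andL2 G A B C : In (And A B) G -> seqt (B :: G) C -> seqt G C.
Proof.
  intros Hin [k Hk]; exists k; intros N HN.
  refine (entails_cut _ _ _ _ (Hk N HN)).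
  apply (entails_log _ _ _ (ax_andE2 (T N false A) _)), (T_In N _ _ Hin).
Qed.

Lemma seqt_allL G A t C : In (All A) G -> seqt (inst A t :: G) C -> seqt G C.
Proof.
  intros Hin [k Hk]; exists k; intros N HN.
  refine (entails_cut _ _ _ _ (Hk N HN)).
  rewrite T_inst; apply entails_allE, (T_In N _ _ Hin).
Qed.

Lemma seqt_boxL G A C : In (Box A) G -> seqt (A :: G) C -> seqt G C.
Proof.
  intros Hin [k Hk]; exists k; intros N HN.
  exact (entails_cut _ _ _ (T_In N _ _ Hin) (Hk N HN)).
Qed.

Lemma seqt_orL G A B C :
  In (Or A B) G -> seqt (A :: G) C -> seqt (B :: G) C -> seqt G C.
Proof.
  intros Hin [k Hk] [l Hl]; exists (max k l); intros N HN.
  apply (entails_cut _ _ _ (T_In N _ _ Hin)).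
  apply entails_orE; fold T.
  - apply (entails_boxes_mono _ k), Hk; lia.
  - apply (entails_boxes_mono _ l), Hl; lia.
Qed.

(** The antecedent of a negative implication is positive, so the first premise supplies exactly
    [T N true A], under [k] boxes. Applying the hypothesis there leaves [B] under [k] boxes, and the
    second premise adds [l] more. *)
Lemma seqt_impL G A B C :
  In (Imp A B) G -> seqt G A -> seqt (B :: G) C -> seqt G C.
Proof.
  intros Hin [k Hk] [l Hl]; exists (k + l); intros N HN.
  rewrite <- boxes_boxes; apply (entails_bind _ _ (T N false B)).
  - apply (entails_bind _ _ _ _ (Hk N ltac:(lia))).
    eapply entails_mp; [apply entails_cons, (T_In N _ _ Hin)|].
    apply entails_hyp; now left.
  - apply Hl; lia.
Qed.

Lemma seqt_andR G A B : seqt G A -> seqt G B -> seqt G (And A B).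
Proof.
  intros [k Hk] [l Hl]; exists (k + l); intros N HN.
  rewrite <- boxes_boxes; apply (entails_bind _ _ _ _ (Hk N ltac:(lia))).
  eapply entails_bind; [apply entails_cons, (Hl N); lia|].
  apply entails_and; apply entails_hyp; simpl; auto.
Qed.

Lemma seqt_orR1 G A B : seqt G A -> seqt G (Or A B).
Proof.
  intros [k Hk]; exists k; intros N HN; generalize (Hk N HN).
  apply entails_boxes_app, thm_log, ax_orI1.
Qed.

Lemma seqt_orR2 G A B : seqt G B -> seqt G (Or A B).
Proof.
  intros [k Hk]; exists k; intros N HN; generalize (Hk N HN).
  apply entails_boxes_app, thm_log, ax_orI2.
Qed.

Lemma seqt_exR G A t : seqt G (inst A t) -> seqt G (Ex A).
Proof.
  intros [k Hk]; exists k; intros N HN; generalize (Hk N HN); rewrite T_inst.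
  apply entails_boxes_app, thm_log, ax_exI.
Qed.

(** The [k] boxes of the premise are padded to the [N] boxes in front of the translated consequent;
    here [k <= N] is what counts. The outer [k] boxes come from [bx_T]. *)
Lemma seqt_impR G A B : seqt (A :: G) B -> seqt G (Imp A B).
Proof.
  intros [k Hk]; exists k; intros N HN.
  apply entails_boxI, entails_intro, (entails_boxes_mono _ _ _ _ HN), (Hk N HN).
Qed.

(** * Eigenvariables and the remaining quantifier rules *)

Definition swap_in (y n : nat) : nat := if n =? y then 0 else S n.

(** [swap_in y] moves the eigenvariable [y] to the index of the new binder and shifts all others.
    Where [y] is fresh it is therefore the lift, and by the next lemma it undoes an instantiation at
    [y]. *)
Lemma rename_swap_in y A : bound A <= y -> rename (swap_in y) A = lift 0 A.
Proof.
  intros H; rewrite lift0_sb; apply sb_agree; intros n Hn; unfold swap_in.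
  destruct (Nat.eqb_spec n y); [lia | reflexivity].
Qed.

Lemma rename_swap_in_inst y A :
  bound A <= S y -> rename (swap_in y) (inst A (tvar y)) = A.
Proof.
  intros H; unfold rename; rewrite sb_inst.
  transitivity (sb tvar A); [|apply sb_id].
  apply sb_agree; intros [|n] Hn; unfold swap_in; simpl.
  - now rewrite Nat.eqb_refl.
  - destruct (Nat.eqb_spec n y); [lia | reflexivity].
Qed.

Lemma entails_rename r G A :
  entails G A -> entails (map (rename r) G) (rename r A).
Proof.
  assert (E : rename r (conj G) = conj (map (rename r) G))
    by (induction G as [|B G IH]; simpl; [reflexivity | now rewrite <- IH]).
  unfold entails; rewrite <- E; intros H; apply (CC2_rename _ H r).
Qed.

Definition fresh (y : nat) (G : list form) : Prop :=
  forall A, In A G -> bound A <= y.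

Lemma fresh_exists G : exists y, fresh y G.
Proof.
  exists (list_max (map bound G)); intros A HA.
  pose proof (proj1 (list_max_le (map bound G) _) (le_n _)) as H.
  rewrite Forall_forall in H; now apply H, in_map.
Qed.

Lemma bound_boxes k A : bound (boxes k A) = bound A.
Proof. induction k; auto. Qed.

Lemma bound_T N A : forall pos, bound (T N pos A) = bound A.
Proof.
  induction A; intros pos; simpl; rewrite ?bound_boxes; auto.
Qed.

Lemma map_rename_T y N G : fresh y G ->
  map (rename (swap_in y)) (map (T N false) G)
  = map (lift 0) (map (T N false) G).
Proof.
  intros H; rewrite !map_map; apply map_ext_in; intros A HA.
  apply rename_swap_in; rewrite bound_T; now apply H.
Qed.

(** Renaming by [swap_in y] turns the named-variable premise into the de Bruijn premise of
    generalization; the [k] boxes then pass outside the quantifier. *)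
Lemma seqt_allR G A y :
  fresh y (All A :: G) -> seqt G (inst A (tvar y)) -> seqt G (All A).
Proof.
  intros Hy [k Hk]; exists k; intros N HN.
  apply entails_boxes_all, entails_allI; fold T.
  pose proof (entails_rename (swap_in y) _ _ (Hk N HN)) as H.
  unfold rename at 2 in H; rewrite sb_boxes, T_inst in H.
  fold (rename (swap_in y)) in H.
  rewrite map_rename_T in H by (intros B HB; apply Hy; now right).
  rewrite rename_swap_in_inst in H; [exact H|].
  rewrite bound_T; specialize (Hy _ (or_introl eq_refl)); simpl in Hy; lia.
Qed.

Lemma seqt_exL G A C y :
  fresh y (C :: Ex A :: G) -> In (Ex A) G ->
  seqt (inst A (tvar y) :: G) C -> seqt G C.
Proof.
  intros Hy Hin [k Hk]; exists k; intros N HN.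
  apply (entails_cut _ _ _ (T_In N _ _ Hin)).
  apply entails_exE; fold T.
  pose proof (entails_rename (swap_in y) _ _ (Hk N HN)) as H; simpl in H.
  rewrite T_inst, map_rename_T in H by (intros B HB; apply Hy; simpl; auto).
  rewrite rename_swap_in_inst in H.
  - rewrite rename_swap_in in H; [exact H|].
    rewrite bound_boxes, bound_T; apply Hy; now left.
  - rewrite bound_T.
    specialize (Hy _ (or_intror (or_introl eq_refl))); simpl in Hy; lia.
Qed.

(** An implication provable in CC'' at the price of [j] boxes acts on the right of a sequent. The
    price is 1 for [pa_nz] and [pa_inj], and 0 in the other uses. *)
Lemma seqt_boxes G A B j :
  (forall N, CC2_thm (Imp (T N true A) (boxes j (T N true B)))) ->
  seqt G A -> seqt G B.
Proof.
  intros H [k Hk]; exists (k + j); intros N HN.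
  rewrite <- boxes_boxes; generalize (Hk N ltac:(lia)).
  apply entails_boxes_app, H.
Qed.

Lemma seqt_thm G A : (forall N, CC2_thm (T N true A)) -> seqt G A.
Proof. intros H; exists 0; intros N _; apply entails_thm, H. Qed.

(** * Semantic cut elimination *)

(** A Kripke-style semantics over contexts ordered by inclusion, with terms as individuals.
    Disjunction and existence are given in continuation form, quantifying over all conclusions [X],
    so that they too are closed under the left rules. *)
Fixpoint force (e : nat -> term) (A : form) (G : list form) : Prop :=
  match A with
  | Mem t u => seqt G (Mem (tsb e t) (tsb e u))
  | Eq t u => seqt G (Eq (tsb e t) (tsb e u))
  | And B C => force e B G /\ force e C G
  | Or B C => forall G' X, incl G G' ->
      (forall G'', incl G' G'' -> force e B G'' \/ force e C G'' -> seqt G'' X) ->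
      seqt G' X
  | Imp B C => forall G', incl G G' -> force e B G' -> force e C G'
  | All B => forall t, force (scons t e) B G
  | Ex B => forall G' X, incl G G' ->
      (forall G'', incl G' G'' -> (exists t, force (scons t e) B G'') -> seqt G'' X) ->
      seqt G' X
  | Box B => force e B G
  end.

Lemma force_mono A : forall e G G', incl G G' -> force e A G -> force e A G'.
Proof.
  induction A; simpl; intros e G G' HG H;
    eauto using seqt_weak, incl_tran; intuition eauto.
Qed.

(** A cover in the sense of Beth semantics: a sequent that holds at all extensions in [P] holds
    already. The clauses of [force] for [Or] and [Ex] are instances of it. *)
Definition covered (P : list form -> Prop) (G : list form) : Prop :=
  forall G' X, incl G G' ->
    (forall G'', incl G' G'' -> P G'' -> seqt G'' X) -> seqt G' X.

(** Forcing is local. At an atom the cover is used with the atom as [X], at [Or] and [Ex] with the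
    [X] of the continuation; the other connectives pass the cover on. *)
Lemma force_covered A : forall e (P : list form -> Prop) G,
  covered P G ->
  (forall G', incl G G' -> P G' -> force e A G') -> force e A G.
Proof.
  assert (Hmono : forall P G G', incl G G' -> covered P G -> covered P G').
  { intros P G G' HG H G'' X HG'; apply H; eauto using incl_tran. }
  induction A; simpl; intros e P G HP H.
  - apply (HP G); auto using incl_refl.
  - apply (HP G); auto using incl_refl.
  - split; [eapply IHA1 | eapply IHA2]; eauto; intros; now apply H.
  - intros G' X HG HX; apply (HP G' X HG); intros G'' HG' HPG.
    apply (H G'' (incl_tran HG HG') HPG G'' X (incl_refl _)).
    intros; apply HX; eauto using incl_tran.
  - intros G' HG HA; apply (IHA2 e P G'); eauto.
    intros G'' HG' HPG; apply (H G'' (incl_tran HG HG') HPG G'' (incl_refl _)).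
    eauto using force_mono.
  - intros t; eapply IHA; eauto; intros; now apply H.
  - intros G' X HG HX; apply (HP G' X HG); intros G'' HG' HPG.
    apply (H G'' (incl_tran HG HG') HPG G'' X (incl_refl _)).
    intros; apply HX; eauto using incl_tran.
  - eauto.
Qed.

(* [B] is the active premise formula of a left rule that is applicable in [G]. *)
Lemma force_left e A B G :
  (forall G', In B G' -> force e A G') ->
  (forall G' X, incl G G' -> seqt (B :: G') X -> seqt G' X) -> force e A G.
Proof.
  intros HB HL; apply (force_covered A e (In B)); auto.
  intros G' X HG HX; apply HL; auto.
  apply HX; [now right | now left].
Qed.

(** The halves are proved together because [Imp] reverses direction: reflecting it reifies the
    antecedent, and reifying it reflects the antecedent. *)
Lemma force_reflect_reify A : forall e G,
  (In (sb e A) G -> force e A G) /\ (force e A G -> seqt G (sb e A)).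
Proof.
  assert (Hin : forall (B : form) G G', In B G -> incl G G' -> In B G') by auto.
  (* The identity sequent is immediate only where both polarities translate alike, as for atoms. For
     compound formulas it results from composing the two halves. *)
  assert (Hax : forall B G, (forall N, T N true B = T N false B) ->
    In B G -> seqt G B).
  { intros B G E HB; exists 0; intros N _; simpl; rewrite E; now apply T_In. }
  induction A; intros e G; simpl.
  - auto.
  - auto.
  - split.
    + intros H; split; [eapply force_left; [apply IHA1|] | eapply force_left; [apply IHA2|]];
        eauto using seqt_andL1, seqt_andL2.
    + intros []; apply seqt_andR; [apply IHA1 | apply IHA2]; auto.
  - split.
    + intros H G' X HG HX; apply (seqt_orL _ (sb e A1) (sb e A2)); auto;
        apply HX; try (now right); [left; apply IHA1 | right; apply IHA2]; now left.
    + intros H; apply H; [apply incl_refl|].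
      intros G' _ [HA|HA]; [apply seqt_orR1, IHA1, HA | apply seqt_orR2, IHA2, HA].
  - split.
    + intros H G' HG HA; eapply force_left; [apply IHA2|].
      intros G'' X HG' HX; eapply seqt_impL; eauto.
      apply (seqt_weak G'); auto; now apply IHA1.
    + intros H; apply seqt_impR, IHA2, H; [now right|].
      apply IHA1; now left.
  - split.
    + intros H t; eapply force_left; [apply IHA|].
      intros G' X HG HX; rewrite <- inst_up in HX; eauto using seqt_allL.
    + intros H; destruct (fresh_exists (All (sb (up e) A) :: G)) as [y Hy].
      apply (seqt_allR _ _ y Hy); rewrite inst_up; apply IHA, H.
  - split.
    + intros H G' X HG HX.
      (* The conclusion [X] must avoid the eigenvariable as well. *)
      destruct (fresh_exists (X :: Ex (sb (up e) A) :: G')) as [y Hy].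
      apply (seqt_exL _ _ _ y Hy); auto.
      apply HX; [now right | exists (tvar y)].
      apply IHA; rewrite <- inst_up; now left.
    + intros H; apply H; [apply incl_refl|].
      intros G' _ [t HA]; apply (seqt_exR _ _ t); rewrite inst_up; now apply IHA.
  - split.
    + intros H; eapply force_left; [apply IHA|]; eauto using seqt_boxL.
    + intros H; apply (seqt_boxes _ (sb e A) _ 0); [intros; apply thm_id | now apply IHA].
Qed.

(** * Substitution and equality in the semantics *)

Lemma force_sb A : forall e f g G,
  (forall n, g n = tsb f (e n)) -> (force f (sb e A) G <-> force g A G).
Proof.
  assert (Ht : forall t e f g, (forall n, g n = tsb f (e n)) ->
    tsb f (tsb e t) = tsb g t).
  { intros t e f g H; rewrite tsb_comp; now apply tsb_ext. }
  assert (Hup : forall t e f g, (forall n, g n = tsb f (e n)) ->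
    forall n, scons t g n = tsb (scons t f) (up e n)).
  { intros t e f g H [|n]; simpl; auto; now rewrite tsb_scons_lift. }
  induction A; intros e f g G H; simpl.
  - now rewrite !(Ht _ e f g H).
  - now rewrite !(Ht _ e f g H).
  - now rewrite (IHA1 e f g), (IHA2 e f g).
  - split; intros HA G' X HG HX; apply (HA G' X HG); intros G'' HG' [HB|HB];
      apply HX; auto; (left; now apply (IHA1 e f g)) || (right; now apply (IHA2 e f g)).
  - split; intros HA G' HG HB; apply (IHA2 e f g), HA, (IHA1 e f g); auto.
  - split; intros HA t; apply (IHA (up e) (scons t f) (scons t g)); auto.
  - split; intros HA G' X HG HX; apply (HA G' X HG); intros G'' HG' [t HB];
      apply HX; auto; exists t; apply (IHA (up e) (scons t f) (scons t g)); auto.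
  - auto.
Qed.

Lemma force_inst A t e G :
  force e (inst A t) G <-> force (scons (tsb e t) e) A G.
Proof. rewrite inst_sb; apply force_sb; intros [|n]; reflexivity. Qed.

Lemma force_lift A t e G : force (scons t e) (lift 0 A) G <-> force e A G.
Proof. rewrite lift0_sb; apply force_sb; reflexivity. Qed.

(** Direct replacement is confined to formulas that the translation leaves unchanged; it is applied
    to atoms, and [force_eq] extends it to all formulas. *)
Lemma seqt_eqsubst A t u G :
  (forall N, T N true A = A) ->
  seqt G (Eq t u) -> seqt G (inst A t) -> seqt G (inst A u).
Proof.
  intros E Heq HA; generalize (seqt_andR _ _ _ Heq HA).
  apply seqt_boxes with (j := 0); intros N; simpl; rewrite !T_inst, E.
  apply thm_ap with (inst A t); [|apply thm_log, ax_andE2].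
  apply thm_trans with (Eq t u); [apply thm_log, ax_andE1 | apply thm_log, ax_eqsubst].
Qed.

Lemma seqt_eqrefl G t : seqt G (Eq t t).
Proof. apply seqt_thm; intros; apply thm_log, ax_eqrefl. Qed.

Lemma seqt_eqsym G t u : seqt G (Eq t u) -> seqt G (Eq u t).
Proof.
  intros H.
  pose proof (seqt_eqsubst (Eq (tvar 0) (lift_term 0 t)) t u G) as E.
  unfold inst in E; simpl in E; rewrite !subst_lift_term in E.
  apply E; auto using seqt_eqrefl.
Qed.

Lemma seqt_eqtrans G s t u : seqt G (Eq s t) -> seqt G (Eq t u) -> seqt G (Eq s u).
Proof.
  intros Hs Ht.
  pose proof (seqt_eqsubst (Eq (lift_term 0 s) (tvar 0)) t u G) as E.
  unfold inst in E; simpl in E; rewrite !subst_lift_term in E; auto.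
Qed.

Lemma seqt_eqsucc G t u : seqt G (Eq t u) -> seqt G (Eq (tsucc t) (tsucc u)).
Proof.
  intros H.
  pose proof (seqt_eqsubst (Eq (lift_term 0 (tsucc t)) (tsucc (tvar 0))) t u G) as E.
  unfold inst in E; simpl in E; rewrite !subst_lift_term in E.
  apply E; auto using seqt_eqrefl.
Qed.

Lemma seqt_eqmem G s t s' t' :
  seqt G (Eq s s') -> seqt G (Eq t t') -> seqt G (Mem s t) -> seqt G (Mem s' t').
Proof.
  intros Hs Ht H.
  pose proof (seqt_eqsubst (Mem (tvar 0) (lift_term 0 t)) s s' G) as E.
  pose proof (seqt_eqsubst (Mem (lift_term 0 s') (tvar 0)) t t' G) as E'.
  unfold inst in E, E'; simpl in E, E'; rewrite !subst_lift_term in E, E'; auto.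
Qed.

Definition eq_env (e f : nat -> term) (G : list form) : Prop :=
  forall n, seqt G (Eq (e n) (f n)).

Lemma eq_env_tsb e f G t : eq_env e f G -> seqt G (Eq (tsb e t) (tsb f t)).
Proof. intros H; induction t; simpl; auto using seqt_eqsucc, seqt_eqrefl. Qed.

Lemma eq_env_sym e f G : eq_env e f G -> eq_env f e G.
Proof. intros H n; apply seqt_eqsym, H. Qed.

Lemma eq_env_mono e f G G' : incl G G' -> eq_env e f G -> eq_env e f G'.
Proof. intros HG H n; apply (seqt_weak G), H; exact HG. Qed.

Lemma eq_env_scons e f t u G :
  seqt G (Eq t u) -> eq_env e f G -> eq_env (scons t e) (scons u f) G.
Proof. intros Ht H [|n]; simpl; auto. Qed.

(** Replacement is lifted from atoms by induction. Whole environments are compared so that a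
    quantifier can extend both by the same term; the antecedent of [Imp] uses symmetry. *)
Lemma force_eq A : forall e f G, eq_env e f G -> force e A G -> force f A G.
Proof.
  induction A; simpl; intros e f G He H.
  - eapply seqt_eqmem; eauto using eq_env_tsb.
  - eapply seqt_eqtrans; [apply seqt_eqsym, eq_env_tsb, He|].
    eapply seqt_eqtrans; [exact H | apply eq_env_tsb, He].
  - destruct H; split; eauto.
  - intros G' X HG HX; apply (H G' X HG); intros G'' HG' HA; apply HX; auto.
    assert (eq_env e f G'') by eauto using eq_env_mono, incl_tran.
    destruct HA; eauto.
  - intros G' HG HA.
    apply (eq_env_mono _ _ _ _ HG) in He.
    apply (IHA2 e f); auto; apply H; auto.
    apply (IHA1 f e); auto using eq_env_sym.
  - intros t; apply (IHA (scons t e)); auto using eq_env_scons, seqt_eqrefl.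
  - intros G' X HG HX; apply (H G' X HG); intros G'' HG' [t HA]; apply HX; auto.
    assert (eq_env e f G'') by eauto using eq_env_mono, incl_tran.
    exists t; apply (IHA (scons t e)); auto using eq_env_scons, seqt_eqrefl.
  - eauto.
Qed.

(** * Soundness of the Hilbert calculus *)

Definition valid (A : form) : Prop := forall e G, force e A G.

Lemma force_bot e A G : force e bot G -> force e A G.
Proof.
  (* Reified absurdity proves every sequent, so even the empty set of contexts is a cover. *)
  intros H; apply (force_covered A e (fun _ => False)); [|tauto].
  intros G' X HG _; apply (seqt_boxes _ bot _ 0).
  - intros N; apply thm_log, ax_efq.
  - apply (force_mono _ _ _ _ HG) in H; exact (proj2 (force_reflect_reify bot e G') H).
Qed.

Lemma LogAx_valid A : LogAx A -> valid A.
Proof.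
  intros [] e G; simpl.
  - intros G1 _ HA G2 H2 _; eauto using force_mono.
  - intros G1 _ HABC G2 H2 HAB G3 H3 HA.
    apply (HABC G3 (incl_tran H2 H3) HA G3 (incl_refl _)); auto.
  - tauto.
  - tauto.
  - intros G1 _ HA G2 H2 HB; split; eauto using force_mono.
  - intros G1 _ HA G' X HG HX; apply HX; [apply incl_refl|].
    left; eauto using force_mono.
  - intros G1 _ HB G' X HG HX; apply HX; [apply incl_refl|].
    right; eauto using force_mono.
  - intros G1 _ HAC G2 H2 HBC G3 H3 HAB.
    (* [HAB] is itself a cover of [G3], by the contexts that force a disjunct. *)
    apply (force_covered _ _ _ _ HAB); intros G4 H4 [HA|HB]; eauto using incl_tran.
  - intros G1 _; apply (force_bot e A0).
  - intros G1 _ HA; apply force_inst, HA.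
  - intros G1 _ HA G' X HG HX; apply HX; [apply incl_refl|].
    exists (tsb e t); apply force_inst; eauto using force_mono.
  - apply seqt_eqrefl.
  - intros G1 _ Heq G2 H2 HA; apply force_inst; apply force_inst in HA.
    revert HA; apply force_eq, eq_env_scons; [eauto using seqt_weak|].
    intros n; apply seqt_eqrefl.
Qed.

Lemma PAmAx_valid A : PAmAx A -> valid A.
Proof.
  intros [|i|i|i j] e G; simpl.
  - apply seqt_thm; intros; apply thm_zero_omega.
  - intros G' _; apply seqt_boxes with (j := 0); intros; apply thm_succ_omega.
  (* To force [bot] is to force every atom [Mem t u], so the boxed absurdity must be turned into a
     boxed membership. *)
  - intros G' _ H t u.
    apply (seqt_boxes _ (Eq (tsucc (e i)) tzero) _ 1); [|exact H].
    intros N; eapply thm_trans; [apply thm_succ_neq_zero|].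
    eapply thm_mp; [apply d_box; [reflexivity | apply bx_K]|].
    eapply thm_mp; [apply d_box; [reflexivity | apply bx_T]|].
    apply thm_log, ax_efq.
  - intros G' _; apply seqt_boxes with (j := 1); intros; apply thm_succ_inj.
Qed.

Lemma PAm_valid A : PAm_thm A -> valid A.
Proof.
  unfold PAm_thm.
  induction 1 as [A H|A H|A H|A B _ IH1 _ IH2|A _ IH|A B _ IH|A B _ IH|A H _ IH];
    try discriminate; intros e G.
  - now apply PAmAx_valid.
  - now apply LogAx_valid.
  (* Modus ponens, the cut, becomes an application of the [Imp] clause at the same context. *)
  - exact (IH1 e G G (incl_refl _) (IH2 e G)).
  - intros t; apply IH.
  - intros G' _ HB t; apply (IH (scons t e) G' G' (incl_refl _)), force_lift, HB.
  - intros G' _ HA; apply (force_covered _ _ _ _ HA); intros G'' HG [t Ht].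
    apply (force_lift B t), (IH _ G'' G'' (incl_refl _)), Ht.
Qed.

(** * Recovering the theorem by erasing boxes *)

Lemma boxfree_erase A : boxfree A = true -> erase A = A.
Proof.
  induction A; simpl; rewrite ?andb_true_iff; intros H; try discriminate;
    f_equal; tauto.
Qed.

Lemma boxfree_sb A : forall e, boxfree (sb e A) = boxfree A.
Proof. induction A; intros e; simpl; congruence. Qed.

Lemma PAm_boxfree A : PAm_thm A -> boxfree A = true.
Proof.
  unfold PAm_thm.
  induction 1 as [A H|A _ H|A H|A B _ IH1 _ IH2|A _ IH|A B _ IH|A B _ IH|A H _ IH];
    simpl in *; try discriminate; auto.
  - now destruct H.
  - now apply andb_true_iff in IH1.
  - now rewrite lift0_sb, boxfree_sb in IH.
  - now rewrite lift0_sb, boxfree_sb in IH.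
Qed.

Theorem theorem6p2 : weakly_interprets CC2_thm PAm_thm.
Proof.
  intros A HA.
  (* Validity is reified at the empty context and the identity environment. The resulting [k] serves
     both as the number of outer boxes and as the least admissible [N]. *)
  pose proof (proj2 (force_reflect_reify A tvar []) (PAm_valid A HA tvar [])) as [k Hk].
  rewrite sb_id in Hk; exists (boxes k (T k true A)); split.
  - exact (thm_mp _ _ (Hk k (le_n k)) (thm_id bot)).
  - rewrite erase_boxes, erase_T; apply boxfree_erase, PAm_boxfree, HA.
Qed.
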